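(* Let $X=(X_1,\dots,X_{d_x})$ be a random vector with values in $\mathbb{R}^{d_x}$ and let $Z$ be a random vector with values in $\mathbb{R}^{d_z}$. Let $\widetilde F_1,\dots,\widetilde F_{d_x}$ be distribution functions on $\mathbb{R}$. Define recursively, for $j=1,\dots,d_x$, $$\widetilde Z^{(1)}=Z,\qquad \widetilde Z^{(j)}=(Z,\widetilde X_1,\dots,\widetilde X_{j-1})\ \ (j>1),\qquad \widetilde X_j=g_j(X_j,\widetilde Z^{(j)})=\widetilde F_j^{\leftarrow}(U_j),$$ where $U_j$ is given as follows. (i) If the conditional distribution function $F_{x_j\mid \tilde z^{(j)}}(\cdot,\widetilde Z^{(j)})$ of $X_j$ given $\widetilde Z^{(j)}$ is continuous (almost surely), then $U_j=F_{x_j\mid \tilde z^{(j)}}(X_j,\widetilde Z^{(j)})$. (ii) If $X_j$ is atomic, with support points $\dot x_1<\dot x_2<\cdots$, then, with $\pi_k=\mathbb{P}[X_j=\dot x_k\mid \widetilde Z^{(j)}]$, $\nu_0=0$ and $\nu_k=\sum_{k'\le k}\pi_{k'}$, $U_j$ is a random variable such that, conditionally on $\widetilde Z^{(j)}$ and $X_j=\dot x_k$, $U_j\sim\mathrm{Uniform}(\nu_{k-1},\nu_k)$. Suppose that for each $j$ one of the cases (i), (ii) holds. Then the conditional law of $\widetilde X=(\widetilde X_1,\dots,\widetilde X_{d_x})$ given $Z$ is, almost surely, the product of the marginal laws of $\widetilde X_1,\dots,\widetilde X_{d_x}$ (that is, $p(\tilde x\mid z)=\prod_{j}p(\tilde x_j)$);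 in particular the random vector $\widetilde X$ is independent of $Z$.
   Context: For a distribution function $F:\mathbb{R}\to[0,1]$, the generalized inverse is $F^{\leftarrow}(p)=\sup\{x\in\mathbb{R}:F(x)\le p\}$. The conditional distribution function is $F_{x_j\mid\tilde z^{(j)}}(x,\tilde z)=\mathbb{P}[X_j\le x\mid \widetilde Z^{(j)}=\tilde z]$ (a regular version). ''Atomic'' means that the distribution is purely discrete, with support points that can be listed in increasing order as a finite or infinite sequence $\dot x_1<\dot x_2<\cdots$. All conditional distributions are the exact ones (assumed known, not estimated). *)

(* Defs.v *)
From HB Require Import structures.
From mathcomp Require Import all_boot all_order all_algebra.
From mathcomp Require Import all_classical all_reals all_analysis.

Set Implicit Arguments.
Unset Strict Implicit.
Unset Printing Implicit Defensive.

Import Order.TTheory GRing.Theory Num.Theory.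
Import numFieldNormedType.Exports.

Local Open Scope classical_set_scope.
Local Open Scope ring_scope.

(* F^<-(p) = sup {x | F x <= p}. The supremum is taken in \bar R since the set
   may be empty (p = 0) or unbounded (p = 1). *)
Definition ginv (R : realType) (F : R -> R) (p : R) : \bar R :=
  ereal_sup [set x%:E | x in [set x : R | F x <= p]].

(* k is a regular version of the conditional law of V given W:
   P[W \in A, V \in B] = E[k(W, B) ; W \in A]. *)
Definition is_cond_law (d d1 d2 : measure_display) (T : measurableType d)
    (E : measurableType d1) (Y : measurableType d2) (R : realType)
    (P : probability T R) (V : T -> Y) (W : T -> E) (k : R.-pker E ~> Y) :=
  forall (A : set E) (B : set Y), measurable A -> measurable B ->
    P (W @^-1` A `&` V @^-1` B) = (\int[P]_(w in W @^-1` A) k (W w) B)%E.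

Definition cond_cdf (d : measure_display) (E : measurableType d)
    (R : realType) (k : R.-pker E ~> R) (z : E) (x : R) : R :=
  fine (k z `]-oo, x]%classic).

Definition continuous_case (d d1 : measure_display) (T : measurableType d)
    (E : measurableType d1) (R : realType) (P : probability T R)
    (X U : T -> R) (W : T -> E) (k : R.-pker E ~> R) :=
  {ae P, forall w, continuous (cond_cdf k (W w))} /\
  {ae P, forall w, U w = cond_cdf k (W w) (X w)}.

(* The law of X is purely discrete, and its atoms are listed in increasing
   order as x 0 < x 1 < ...; the index set D is a finite initial segment of nat
   or the whole of nat. *)
Definition atomic_support (d : measure_display) (T : measurableType d)
    (R : realType) (P : probability T R) (X : T -> R)
    (D : set nat) (x : nat -> R) :=
  [/\ (exists n, D = `I_n) \/ D = [set: nat],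
      (forall i j, D i -> D j -> (i < j)%N -> x i < x j),
      (forall i, D i -> (0 < P (X @^-1` [set x i]))%E) &
      P (X @^-1` (x @` D)) = 1%E].

(* Since indices start at 0, [cond_cum k x n z] is nu_n = pi_1 + ... + pi_n,
   with pi_{i+1} = P[X = x i | W = z]. *)
Definition cond_cum (d : measure_display) (E : measurableType d)
    (R : realType) (k : R.-pker E ~> R) (x : nat -> R) (n : nat) (z : E) : R :=
  \sum_(i < n) fine (k z [set x i]).

(* Given (W, X) with X = x i, the law of U is uniform on (nu_i, nu_{i+1}).
   Almost surely nu_i < nu_{i+1} on the event X = x i, hence quantifying over
   the proof [lt_nu] only discards a null event. *)
Definition atomic_case (d d1 : measure_display) (T : measurableType d)
    (E : measurableType d1) (R : realType) (P : probability T R)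
    (X U : T -> R) (W : T -> E) (k : R.-pker E ~> R) :=
  exists (D : set nat) (x : nat -> R), atomic_support P X D x /\
  exists2 l : R.-pker (E * R) ~> R,
    is_cond_law P U (fun w => (W w, X w)) l &
    {ae P, forall w, forall i, D i -> X w = x i ->
      forall (lt_nu : cond_cum k x i (W w) < cond_cum k x i.+1 (W w))
             (B : set R), measurable B ->
      l (W w, X w) B = uniform_prob lt_nu B}.

(* (Z, Xt_0, ..., Xt_{j-1}) *)
Definition augmented (T : Type) (R : realType) (dx dz : nat)
    (Z : T -> dz.-tuple R) (Xt : T -> dx.-tuple R) (j : 'I_dx) (w : T) :
    (dz.-tuple R * j.-tuple R)%type :=
  (Z w, [tuple tnth (Xt w) (widen_ord (ltnW (ltn_ord j)) i) | i < j]).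

Definition is_product_law (R : realType) (n : nat)
    (mu : set (n.-tuple R) -> \bar R) (m : 'I_n -> set R -> \bar R) :=
  forall B : 'I_n -> set R, (forall j, measurable (B j)) ->
    mu [set t | forall j, B j (tnth t j)] = (\prod_(j < n) m j (B j))%E.

Definition independent_rv (d d1 d2 : measure_display) (T : measurableType d)
    (Y1 : measurableType d1) (Y2 : measurableType d2) (R : realType)
    (P : probability T R) (V : T -> Y1) (W : T -> Y2) :=
  forall (A : set Y1) (B : set Y2), measurable A -> measurable B ->
    P (V @^-1` A `&` W @^-1` B) = (P (V @^-1` A) * P (W @^-1` B))%E.

(* Main.v *)
Require Import Defs.
From HB Require Import structures.
From mathcomp Require Import all_boot all_order all_algebra.
From mathcomp Require Import all_classical all_reals all_analysis.
From mathcomp Require Import measurable_realfun.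

Set Implicit Arguments.
Unset Strict Implicit.
Unset Printing Implicit Defensive.

Import Order.TTheory GRing.Theory Num.Theory.
Import numFieldNormedType.Exports.

Local Open Scope classical_set_scope.
Local Open Scope ring_scope.

(** Conditionally on the augmented vector [W = (Z, Xt_0, ..., Xt_{j-1})], the
    variable [U j] is uniform on [0, 1]: in the continuous case this is the
    probability integral transform; in the atomic case the part of
    [P[W \in A, U < u]] carried by the atom [x i] is the integral over
    [W \in A] of [min(u, nu_{i+1}(W)) - min(u, nu_i(W))], and these telescope.
    Hence [U j], and therefore [Xt_j], a function of it, is independent of [W].
    Chaining these independences over [j] gives
    [P[Z \in A, Xt_0 \in B_0, ...] = P[Z \in A] * \prod_j P[Xt_j \in B_j]]. *)

(** * Disintegration *)

(** A conditional law is given only through integrals over rectangles, and this shapes both cases.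
    In the continuous case the event [U j < u] is not a rectangle in [(W, X)], so the defining
    identity is first extended to all measurable sets of the product. In the atomic case [U j] is
    not a function of [(W, X)]: it has its own kernel given [(W, X)], whose values contain a
    division by the conditional mass of the atom, and integrating [X] out multiplies by that mass
    again. What passes to independence is the factorization P[W \in A, U < u] = c(u) P[W \in A] with
    [c] free of [A]. Finally, the conclusion concerns an arbitrary version of the conditional law,
    with one null set for all boxes; since each box brings its own null set, the comparison is made
    on countably many boxes. *)

Section pker_theory.
Context (d1 d2 : measure_display) (E : measurableType d1)
  (Y : measurableType d2) (R : realType) (k : R.-pker E ~> Y).

Lemma pker_le1 z (B : set Y) : measurable B -> (k z B <= 1)%E.
Proof.
by move=> mB; rewrite -(prob_kernel (s := k) z); apply: le_measure; rewrite ?inE.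
Qed.

Lemma pker_fin_num z (B : set Y) : measurable B -> k z B \is a fin_num.
Proof.
move=> mB; rewrite ge0_fin_numE//.
by apply: le_lt_trans (pker_le1 z mB) _; rewrite ltry.
Qed.

(** An alias of [k z] that carries the structure of a probability, so that results on probabilities
    apply to the kernel at a fixed point. *)
Definition pker_prob (z : E) : set Y -> \bar R := k z.

HB.instance Definition _ z := isMeasure.Build _ _ _ (pker_prob z)
  (measure0 (k z)) (measure_ge0 (k z)) (@measure_semi_sigma_additive _ _ _ (k z)).
HB.instance Definition _ z :=
  Measure_isProbability.Build _ _ _ (pker_prob z) (prob_kernel z).

Lemma pker_setC z (B : set Y) : measurable B -> k z (~` B) = (1 - k z B)%E.
Proof. exact: (probability_setC (pker_prob z)). Qed.

End pker_theory.

Lemma ae_iff_measure (d : measure_display) (T : measurableType d)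
    (R : realType) (mu : {measure set T -> \bar R}) (A B : set T) :
  measurable A -> measurable B -> {ae mu, forall w, A w <-> B w} ->
  mu A = mu B.
Proof.
move=> mA mB AB; rewrite -[A]setIT -[B]setIT -!integral_indic//.
apply: ge0_ae_eq_integral => //.
- exact/measurable_EFinP.
- exact/measurable_EFinP.
- apply: filterS AB => w AB _; rewrite !indicE.
  by rewrite (_ : (w \in A) = (w \in B))//; apply/idP/idP; rewrite !inE => /AB.
Qed.

Section kernel_mixture.
Context (d d1 d2 : measure_display) (T : measurableType d)
  (E : measurableType d1) (Y : measurableType d2) (R : realType)
  (P : probability T R) (W : {mfun T >-> E}) (k : R.-pker E ~> Y).

(** The joint law of [(W, V)] rebuilt from [W] and the kernel. *)
Definition kmixture (C : set (E * Y)) :=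
  (\int[P]_w k (W w) (xsection C (W w)))%E.

Lemma measurable_pker_xsection (C : set (E * Y)) : measurable C ->
  measurable_fun [set: T] (fun w => k (W w) (xsection C (W w)) : \bar R).
Proof.
move=> mC; apply: (@measurableT_comp _ _ _ _ _ _ (fun z => k z (xsection C z))) => //.
by apply: measurable_fun_xsection_finite_kernel; rewrite inE.
Qed.

Let kmixture0 : kmixture set0 = 0%E.
Proof.
by apply: integral0_eq => w _; rewrite xsection0 measure0.
Qed.

Let kmixture_ge0 C : (0 <= kmixture C)%E.
Proof. exact: integral_ge0. Qed.

Let kmixture_sigma_additive : semi_sigma_additive kmixture.
Proof.
move=> F mF tF mUF; rewrite /kmixture.
under [X in _ --> X]eq_integral => w _.
  rewrite xsection_bigcup measure_bigcup//; last 2 first.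
  - by move=> i _; exact: measurable_xsection.
  - exact: trivIset_xsection.
  rewrite (@eq_eseriesl _ _ xpredT); last by move=> i; rewrite in_setT.
  over.
rewrite integral_nneseries//.
  by apply: is_cvg_nneseries => n _ _; exact: integral_ge0.
by move=> n; exact: measurable_pker_xsection.
Qed.

HB.instance Definition _ := isMeasure.Build _ _ _ kmixture
  kmixture0 kmixture_ge0 kmixture_sigma_additive.

End kernel_mixture.

Section conditional_law.
Context (d d1 d2 : measure_display) (T : measurableType d)
  (E : measurableType d1) (Y : measurableType d2) (R : realType)
  (P : probability T R) (V : {mfun T >-> Y}) (W : {mfun T >-> E})
  (k : R.-pker E ~> Y).
Hypothesis kP : is_cond_law P V W k.

(** Rectangles form a pi-system generating the product sigma-algebra, and on them the law of
    [(W, V)] and [kmixture] agree by definition of a conditional law. *)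
Lemma cond_law_prod (C : set (E * Y)) : measurable C ->
  P [set w | C (W w, V w)] = (\int[P]_w k (W w) (xsection C (W w)))%E.
Proof.
have mWV : measurable_fun [set: T] (fun w => (W w, V w)).
  exact: measurable_fun_pair.
pose WV := mfun_Sub (mem_set mWV : _ \in mfun).
apply: (measure_unique
  [set A `*` B | A in @measurable _ E & B in @measurable _ Y]
  (fun=> setT) _ _ _ _ (distribution P WV) (kmixture P W k)).
- exact: measurable_prod_measurableType.
- move=> _ _ [A1 mA1 [B1 mB1 <-]] [A2 mA2 [B2 mB2 <-]].
  exists (A1 `&` A2); first exact: measurableI.
  by exists (B1 `&` B2); [exact: measurableI|rewrite setXI].
- by move=> _; exists setT => //; exists setT => //; rewrite setXTT.
- by rewrite bigcup_const.
- move=> _ [A mA [B mB <-]].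
  transitivity (P (W @^-1` A `&` V @^-1` B)); first by [].
  rewrite kP// integral_mkcond; apply: eq_integral => w _.
  rewrite patchE; case: ifPn => WA; first by rewrite in_xsectionX.
  by rewrite notin_xsectionX// measure0.
- by move=> _; rewrite -ge0_fin_numE ?fin_num_measure.
Qed.

End conditional_law.

Section integral_comp.
Context (d d1 : measure_display) (T : measurableType d)
  (E : measurableType d1) (R : realType) (mu : {measure set T -> \bar R})
  (W : {mfun T >-> E}).
Local Open Scope ereal_scope.
Import HBNNSimple.

(** Monotone convergence along simple functions increasing to [f]. The right-hand side sees [g] only
    through its integrals over events of the form [W \in A]. Finiteness of [g] makes multiplication
    by [g w] pass to the limit. *)
Lemma ge0_integral_compM_lim (f : E -> \bar R) (g : T -> \bar R)
    (mf : measurable_fun [set: E] f) :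
  (forall z, 0 <= f z) -> measurable_fun [set: T] g -> (forall w, 0 <= g w) ->
  (forall w, g w \is a fin_num) ->
  \int[mu]_w (f (W w) * g w) = limn (fun n =>
    \sum_(r \in range (nnsfun_approx measurableT mf n))
      (r%:E * \int[mu]_(w in W @^-1` (nnsfun_approx measurableT mf n @^-1` [set r]))
        g w)).
Proof.
move=> f0 mg g0 gfin; set f_ := nnsfun_approx measurableT mf.
have mfW n : measurable_fun [set: T] (fun w => (f_ n (W w))%:E).
  by apply/measurable_EFinP; exact: measurableT_comp.
have f_0 n z : 0 <= (f_ n z)%:E by rewrite lee_fin.
have mpre n r : measurable (W @^-1` (f_ n @^-1` [set r])).
  by do 2 apply: measurable_funPTI.
transitivity (\int[mu]_w (fun w => limn (fun n => (f_ n (W w))%:E * g w)) w).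
  apply: eq_integral => w _; apply/esym/cvg_lim => //.
  by apply: cvgeZr => //; exact: cvg_nnsfun_approx.
rewrite monotone_convergence//; last 3 first.
- by move=> n; exact: emeasurable_funM.
- by move=> n w _; rewrite mule_ge0.
- move=> w _ m n mn; rewrite lee_wpmul2r// lee_fin.
  by have /lefP := nd_nnsfun_approx measurableT mf mn; exact.
apply/congr_lim/funext => n.
transitivity (\int[mu]_w \sum_(r \in range (f_ n))
    (r%:E * ((\1_(f_ n @^-1` [set r]) (W w))%:E * g w))).
  apply: eq_integral => w _; rewrite {1}fimfunE.
  rewrite -fsumEFin// ge0_mule_fsuml; last first.
    by move=> r; rewrite EFinM nnfun_muleindic_ge0.
  by apply: eq_fsbigr => r _; rewrite EFinM muleA.
have mI n' r : measurable_fun [set: T]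
    (fun w => (\1_(f_ n' @^-1` [set r]) (W w))%:E * g w).
  apply: emeasurable_funM => //; apply/measurable_EFinP.
  apply: measurableT_comp (measurable_funPT W); apply: measurable_indic.
  exact: measurable_funPTI.
rewrite ge0_integral_fsum//; last 2 first.
- by move=> r; apply: emeasurable_funM.
- move=> r w _; rewrite muleA mule_ge0//.
  by rewrite -EFinM nnfun_muleindic_ge0.
(* A negative level has empty preimage and contributes 0 on both sides; a nonnegative one can be
   taken out of the integral. *)
apply: eq_fsbigr => r _; have [r0|r0] := leP 0%R r; last first.
  rewrite !preimage_nnfun0// preimage_set0 integral_set0 mule0.
  by apply: integral0_eq => w _; rewrite indic0 mul0e mule0.
rewrite ge0_integralZl//; last by move=> w _; rewrite mule_ge0// lee_fin.
congr *%E; rewrite [RHS]integral_mkcond; apply: eq_integral => w _.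
rewrite patchE indicE.
rewrite (_ : (W w \in _) = (w \in W @^-1` (f_ n @^-1` [set r])))//.
by case: ifPn => _; rewrite ?mul1e ?mul0e.
Qed.

Lemma ge0_integral_compM_eq (f : E -> \bar R) (g1 g2 : T -> \bar R) :
  measurable_fun [set: E] f -> (forall z, 0 <= f z) ->
  measurable_fun [set: T] g1 -> (forall w, 0 <= g1 w) ->
  (forall w, g1 w \is a fin_num) ->
  measurable_fun [set: T] g2 -> (forall w, 0 <= g2 w) ->
  (forall w, g2 w \is a fin_num) ->
  (forall A, measurable A ->
    \int[mu]_(w in W @^-1` A) g1 w = \int[mu]_(w in W @^-1` A) g2 w) ->
  \int[mu]_w (f (W w) * g1 w) = \int[mu]_w (f (W w) * g2 w).
Proof.
move=> mf f0 mg1 g10 g1f mg2 g20 g2f g12; rewrite !(ge0_integral_compM_lim mf)//.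
by apply/congr_lim/funext => n; apply: eq_fsbigr => r _; rewrite g12//.
Qed.

End integral_comp.

Section cond_law_integral.
Context (d d1 d2 : measure_display) (T : measurableType d)
  (E : measurableType d1) (Y : measurableType d2) (R : realType)
  (P : probability T R) (V : {mfun T >-> Y}) (W : {mfun T >-> E})
  (k : R.-pker E ~> Y).
Hypothesis kP : is_cond_law P V W k.

Lemma measurable_pker_comp (B : set Y) : measurable B ->
  measurable_fun [set: T] (fun w => k (W w) B).
Proof. by move=> mB; exact: (measurableT_comp (measurable_kernel k B mB)). Qed.

(** By definition of [k], the indicator of [V \in B] and [k (W w) B] have the same integrals over
    the events determined by [W], hence also against any nonnegative weight that is a function of
    [W]. The set [A] is absorbed into the weight. *)
Lemma cond_law_integral (f : E -> \bar R) (A : set E) (B : set Y) :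
  measurable_fun [set: E] f -> (forall z, 0 <= f z)%E ->
  measurable A -> measurable B ->
  (\int[P]_(w in W @^-1` A `&` V @^-1` B) f (W w) =
   \int[P]_(w in W @^-1` A) (f (W w) * k (W w) B))%E.
Proof.
move=> mf f0 mA mB.
have mVB : measurable (V @^-1` B).
  by apply: measurable_funPTI.
have mWA A' : measurable A' -> measurable (W @^-1` A').
  exact: measurable_funPTI.
have fA z : (f z * (\1_A z)%:E)%E = (f \_ A) z.
  by rewrite patchE indicE; case: ifPn => _; rewrite (mule1, mule0).
pose fA' z := (f z * (\1_A z)%:E)%E.
rewrite integral_mkcond [RHS]integral_mkcond.
transitivity (\int[P]_w (fA' (W w) * (\1_(V @^-1` B) w)%:E))%E.
  apply: eq_integral => w _; rewrite /fA' fA !patchE.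
  rewrite in_setI indicE (_ : (W w \in A) = (w \in W @^-1` A))//.
  by do 2 case: (w \in _); rewrite ?(mul0e, mule1, mule0).
transitivity (\int[P]_w (fA' (W w) * k (W w) B))%E; last first.
  apply: eq_integral => w _; rewrite /fA' fA !patchE.
  rewrite (_ : (W w \in A) = (w \in W @^-1` A))//.
  by case: ifPn => // _; rewrite mul0e.
apply: ge0_integral_compM_eq => //.
- by apply: emeasurable_funM => //; apply/measurable_EFinP.
- by move=> z; rewrite mule_ge0// lee_fin.
- by apply/measurable_EFinP.
- exact: measurable_pker_comp.
- by move=> w; exact: pker_fin_num.
- move=> A' mA'; rewrite integral_indic//; last exact: mWA.
  by rewrite setIC; exact: kP.
Qed.

End cond_law_integral.

(** * Uniformity, continuous case *)

(* The distribution function of the uniform law on [0, 1], written so that the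
   contributions of the atoms telescope to it. *)
Definition unif_cdf (R : realType) (u : R) : R := Num.min u 1 - Num.min u 0.

Lemma unif_cdf_ge0 (R : realType) (u : R) : 0 <= unif_cdf u.
Proof. by rewrite subr_ge0; rewrite le_min !ge_min !lexx ler01 !orbT. Qed.

Section probability_integral_transform.
Context (R : realType) (mu : probability R R).
Let F (x : R) : R := fine (mu `]-oo, x]%classic).

Lemma fine_cdf_nondecreasing : nondecreasing_fun F.
Proof.
move=> x y xy; apply: fine_le; rewrite ?fin_num_measure//.
by apply: le_measure; rewrite ?inE//; exact: subitvPr.
Qed.

(** Intermediate value theorem, between points supplied by the limits 0 and 1 at infinity. These
    limits need not be attained, hence the strict bounds on [v]. *)
Lemma fine_cdf_surj (v : R) : continuous F -> 0 < v < 1 -> exists s, F s = v.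
Proof.
move=> cF /andP[v0 v1].
pose X : {RV mu >-> R} := mfun_Sub (mem_set (@measurable_id _ R setT) : _ \in mfun).
have FX x : F x = fine (cdf X x) by [].
have [a Fa] : exists a, F a < v.
  have /fine_cvgP[_ /cvgr_lt] := cvg_cdfNy0 X.
  by move=> /(_ _ v0) /filter_ex[a Xa]; exists a.
have [b Fb] : exists b, v < F b.
  have /fine_cvgP[_ /cvgr_gt] := cvg_cdfy1 X.
  by move=> /(_ _ v1) /filter_ex[b Xb]; exists b.
have ab : a <= b.
  rewrite leNgt; apply/negP => ba.
  have := lt_trans Fa Fb; rewrite ltNge => /negP; apply.
  by apply: fine_cdf_nondecreasing; exact: ltW.
have [| |s _ <-] := @IVT _ F a b v ab; last by exists s.
- exact: continuous_subspaceT.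
- rewrite minElt maxElt (lt_trans Fa Fb).
  by rewrite !ltW.
Qed.

Lemma measurable_fine_cdf : measurable_fun [set: R] F.
Proof. exact: nondecreasing_measurable fine_cdf_nondecreasing. Qed.

Lemma probability_fine_cdf_lt (u : R) : continuous F ->
  mu [set x | F x < u] = (unif_cdf u)%:E.
Proof.
move=> cF; set S := [set x | F x < u].
have mS : measurable S.
  rewrite (_ : S = F @^-1` `]-oo, u[%classic); last first.
    by apply/seteqP; split => x /=; rewrite in_itv.
  by rewrite -[X in measurable X]setTI; exact: measurable_fine_cdf.
rewrite /unif_cdf; have [u0|u0] := leP u 0.
  rewrite (_ : S = set0) ?measure0.
    by rewrite min_l ?subrr// (le_trans u0).
  rewrite -subset0 => x; rewrite /S/= ltNge => /negP; apply.
  by rewrite (le_trans u0)// fine_ge0.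
rewrite subr0 -(fineK (fin_num_measure mu S mS)); congr EFin.
apply/eqP; rewrite eq_le; apply/andP; split.
  have [u1|u1] := leP 1 u.
    by rewrite -lee_fin fineK ?fin_num_measure// probability_le1.
  (* Upper bound: if [F s = u], monotonicity puts [S] inside the half-line up to [s], of mass
     [u]. *)
  have [|s Fs] := fine_cdf_surj cF (v := u); first by rewrite u0.
  rewrite -[leRHS]Fs; apply: fine_le; rewrite ?fin_num_measure//.
  apply: le_measure; rewrite ?inE// => x; rewrite /S/= in_itv/= -Fs.
  by apply: contraTT; rewrite -leNgt -ltNge => /ltW; exact: fine_cdf_nondecreasing.
(* Lower bound: a level [v] strictly between the mass of [S] and [Num.min u 1] is attained at some
   [s]; as [v < u], the half-line up to [s], of mass [v], lies in [S], a contradiction. *)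
rewrite leNgt; apply/negP => lt_mu.
have [lt1 lt2] := midf_lt lt_mu.
set v := (_ / 2) in lt1 lt2.
have v0 : 0 < v by apply: le_lt_trans lt1; exact: fine_ge0.
have := lt2; rewrite lt_min => /andP[vu v1].
have [|s Fs] := fine_cdf_surj cF (v := v); first by rewrite v0.
move: lt1; rewrite -Fs ltNge => /negP; apply; apply: fine_le; rewrite ?fin_num_measure//.
apply: le_measure; rewrite ?inE// => x; rewrite /S/= in_itv/= => xs.
by apply: le_lt_trans vu; rewrite -Fs; exact: fine_cdf_nondecreasing.
Qed.

End probability_integral_transform.

Section continuous_case_uniform.
Context (d d1 : measure_display) (T : measurableType d)
  (E : measurableType d1) (R : realType) (P : probability T R)
  (X U : {mfun T >-> R}) (W : {mfun T >-> E}) (k : R.-pker E ~> R).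
Hypothesis kP : is_cond_law P X W k.

Lemma pker_cond_cdf_lt z (u : R) : continuous (cond_cdf k z) ->
  k z [set x | cond_cdf k z x < u] = (unif_cdf u)%:E.
Proof.
exact: (@probability_fine_cdf_lt _ (pker_prob k z)).
Qed.

Lemma cond_cdf_nondecreasing z : nondecreasing_fun (cond_cdf k z).
Proof.
move=> x y xy; apply: fine_le; rewrite ?pker_fin_num//.
by apply: le_measure; rewrite ?inE//; exact: subitvPr.
Qed.

(* By right continuity, [F x < u] iff [x < q] and [F q < u] for some rational
   [q]. *)
Let below (u : R) : set (E * R) :=
  \bigcup_(q : rat) ([set z | cond_cdf k z (ratr q) < u] `*` `]-oo, ratr q[%classic).

Let measurable_below u : measurable (below u).
Proof.
apply: bigcupT_measurable_rat => q; apply: measurableX => //.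
have mc : measurable_fun [set: E] (cond_cdf k ^~ (ratr q)).
  apply: measurableT_comp => //; exact: measurable_kernel.
rewrite (_ : [set z | _] = (cond_cdf k ^~ (ratr q)) @^-1` `]-oo, u[%classic).
  by rewrite -[X in measurable X]setTI; exact: mc.
by apply/seteqP; split => x /=; rewrite in_itv.
Qed.

Let belowE z x u : continuous (cond_cdf k z) ->
  below u (z, x) <-> cond_cdf k z x < u.
Proof.
move=> cF; split => [[q _ [/= Fq]]|Fx].
  rewrite in_itv/= => xq; apply: le_lt_trans Fq.
  by apply: cond_cdf_nondecreasing; exact: ltW.
have /cvgr_lt /(_ _ Fx) := cF x.
move=> /nbhs_ballP[e /= e0 xe].
have [q /[!in_itv]/= /andP[xq qe]] := rat_in_itvoo (ltr_pwDr e0 (lexx x)).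
exists q => //; split => /=; last by rewrite in_itv.
apply: xe; rewrite /ball/= distrC gtr0_norm ?subr_gt0//.
by rewrite ltrBlDl.
Qed.

(** Up to a null event, [U < u] says that [(W, X)] lies in the measurable set [below u].
    Disintegrating, almost every section has mass [unif_cdf u] by the probability integral transform
    for [k (W w)]. *)
Lemma continuous_case_unif (A : set E) (u : R) :
  continuous_case P X U W k -> measurable A ->
  P (W @^-1` A `&` U @^-1` `]-oo, u[) = ((unif_cdf u)%:E * P (W @^-1` A))%E.
Proof.
move=> [cF UF] mA.
have mC : measurable (below u `&` A `*` setT).
  by apply: measurableI => //; exact: measurableX.
have mWX : measurable_fun [set: T] (fun w => (W w, X w)).
  exact: measurable_fun_pair.
have mB : measurable [set w | (below u `&` A `*` setT) (W w, X w)].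
  by rewrite -[X in measurable X]setTI; exact: mWX.
have mWA : measurable (W @^-1` A) by exact: measurable_funPTI.
have mWU : measurable (W @^-1` A `&` U @^-1` `]-oo, u[).
  by apply: measurableI => //; exact: measurable_funPTI.
transitivity (P [set w | (below u `&` A `*` setT) (W w, X w)]).
  apply: ae_iff_measure => //.
  apply: filterS2 cF UF => w cF UF; rewrite /= in_itv/= UF.
  by rewrite -belowE//; split => [[? ?]|[? [? _]]].
rewrite (cond_law_prod kP mC).
transitivity (\int[P]_w ((unif_cdf u)%:E * (\1_(W @^-1` A) w)%:E))%E; last first.
  rewrite ge0_integralZl//.
  - by rewrite integral_indic// setIT.
  - exact/measurable_EFinP.
  - by rewrite lee_fin unif_cdf_ge0.
apply: ge0_ae_eq_integral => //.
- exact: measurable_pker_xsection.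
- by apply: emeasurable_funM => //; exact/measurable_EFinP.
- by move=> w _; rewrite mule_ge0// lee_fin unif_cdf_ge0.
- apply: filterS cF => w cF _.
  have uE x : below u (W w, x) <-> cond_cdf k (W w) x < u by exact: belowE.
  rewrite indicE -(pker_cond_cdf_lt u cF).
  have [WA|WA] := boolP (w \in W @^-1` A).
    rewrite mule1; congr (k _ _); apply/seteqP; split => x.
      by rewrite /xsection/= inE => -[/uE].
    rewrite /xsection/= inE => Fx; split; first exact/uE.
    by split => //; rewrite inE in WA.
  rewrite mule0 (_ : xsection _ _ = set0) ?measure0// -subset0 => x.
  rewrite /xsection/= inE => -[_ [/= WA' _]].
  by move/negP: WA; rewrite inE.
Qed.

End continuous_case_uniform.

(** * Uniformity, atomic case *)

(** The difference of minima is the length of the part of [[a, b]] below [u], whatever the position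
    of [u]; in this form the lengths for adjacent intervals telescope. *)
Lemma uniform_prob_lt (R : realType) (a b : R) (ab : a < b) (u : R) :
  uniform_prob ab `]-oo, u[%classic = ((Num.min u b - Num.min u a) / (b - a))%:E.
Proof.
have itvE : `]-oo, u[%classic `&` `[a, b]%classic =
    if u <= b then `[a, u[%classic else `[a, b]%classic.
  apply/seteqP; split => x; case: ifPn => ub /=; rewrite !in_itv/=.
  - by move=> [xu /andP[-> _]].
  - by move=> [].
  - by move=> /andP[-> xu]; split => //=; rewrite (ltW (lt_le_trans xu ub)).
  - move=> /andP[-> xb]; split => //; rewrite -ltNge in ub.
    exact: le_lt_trans xb ub.
rewrite /uniform_prob integral_uniform_pdf.
under eq_integral => x.
  rewrite inE/= => -[_]; rewrite in_itv/= => xab.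
  rewrite /uniform_pdf xab.
  over.
rewrite integral_cst/=; last exact: measurableI.
rewrite [X in (_ * X)%E](_ : _ = (Num.min u b - Num.min u a)%:E).
  by rewrite -EFinM mulrC.
rewrite itvE; case: ifPn => ub; rewrite lebesgue_measure_itv/= lte_fin.
  by have [au|ua] := ltP a u; rewrite (min_l ub) ?subrr.
rewrite -ltNge in ub; rewrite ab (min_r (ltW ub)) (min_r (ltW (lt_trans ab ub))).
by rewrite EFinB.
Qed.

Section cond_law_pos.
Context (d d1 d2 : measure_display) (T : measurableType d)
  (E : measurableType d1) (Y : measurableType d2) (R : realType)
  (P : probability T R) (V : {mfun T >-> Y}) (W : {mfun T >-> E})
  (k : R.-pker E ~> Y).
Hypothesis kP : is_cond_law P V W k.

(** P[k(W, B) = 0, V \in B] is the integral of [k (W w) B] over the event where it vanishes. Applied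
    to an atom, this makes the realized atom have positive conditional mass almost surely. *)
Lemma cond_law_gt0 (B : set Y) : measurable B ->
  {ae P, forall w, B (V w) -> (0 < k (W w) B)%E}.
Proof.
move=> mB; set A := [set z | k z B = 0%E].
have mA : measurable A.
  rewrite (_ : A = (k ^~ B) @^-1` [set 0%E]); last by [].
  by rewrite -[X in measurable X]setTI; apply: (measurable_kernel k B mB).
exists (W @^-1` A `&` V @^-1` B); split.
- by apply: measurableI; exact: measurable_funPTI.
- rewrite -[LHS]/(P (W @^-1` A `&` V @^-1` B)) kP//.
  by apply: integral0_eq => w.
- move=> w /= /not_implyP[Bw]; rewrite lt0e measure_ge0 andbT => /negP.
  by rewrite negbK => /eqP kw; split.
Qed.

End cond_law_pos.

Lemma cond_cum0 (d : measure_display) (E : measurableType d)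
    (R : realType) (k : R.-pker E ~> R) (x : nat -> R) (z : E) :
  cond_cum k x 0 z = 0.
Proof. by rewrite /cond_cum big_ord0. Qed.

Lemma cond_cumS (d : measure_display) (E : measurableType d)
    (R : realType) (k : R.-pker E ~> R) (x : nat -> R) n (z : E) :
  cond_cum k x n.+1 z = cond_cum k x n z + fine (k z [set x n]).
Proof. by rewrite /cond_cum big_ord_recr. Qed.

Lemma cond_cum_ge0 (d : measure_display) (E : measurableType d)
    (R : realType) (k : R.-pker E ~> R) (x : nat -> R) n (z : E) :
  0 <= cond_cum k x n z.
Proof. by apply: sumr_ge0 => i _; exact: fine_ge0. Qed.

Lemma le_cond_cumS (d : measure_display) (E : measurableType d)
    (R : realType) (k : R.-pker E ~> R) (x : nat -> R) n (z : E) :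
  cond_cum k x n z <= cond_cum k x n.+1 z.
Proof. by rewrite cond_cumS lerDl fine_ge0. Qed.

Lemma measurable_cond_cum (d : measure_display) (E : measurableType d)
    (R : realType) (k : R.-pker E ~> R) (x : nat -> R) n :
  measurable_fun [set: E] (cond_cum k x n).
Proof.
apply: measurable_sum => i; apply: measurableT_comp => //.
exact: measurable_kernel.
Qed.

(** Serves to bound nu_n by 1 and to read 1 - nu_n as the conditional mass outside the first [n]
    atoms. *)
Lemma cond_cumE (d : measure_display) (E : measurableType d)
    (R : realType) (k : R.-pker E ~> R) (x : nat -> R) n (z : E) :
  {in `I_n &, injective x} ->
  k z [set x i | i in `I_n] = (cond_cum k x n z)%:E.
Proof.
elim: n => [|n IHn] xI; first by rewrite cond_cum0 II0 image_set0 measure0.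
rewrite cond_cumS EFinD fineK ?pker_fin_num// -IHn; last first.
  move=> i j; rewrite !inE => iI jI; apply: xI; rewrite inE/=.
    exact: ltnW.
  exact: ltnW.
rewrite IIS image_setU image_set1 measureU//.
  apply: countable_measurable => //.
  exact/finite_set_countable/finite_image/finite_II.
rewrite -subset0 => _ [[i/= iI <-]] xin.
have := xI _ _ _ _ xin; rewrite !inE/= => /(_ (ltnW iI) (ltnSn _)) E'.
by rewrite E' ltnn in iI.
Qed.

Lemma measurable_image_II (R : realType) (x : nat -> R) n :
  measurable (x @` `I_n).
Proof.
apply: countable_measurable => //.
exact/finite_set_countable/finite_image/finite_II.
Qed.

Section atoms.
Context (d d1 : measure_display) (T : measurableType d)
  (E : measurableType d1) (R : realType) (P : probability T R)
  (X U : {mfun T >-> R}) (W : {mfun T >-> E}) (k : R.-pker E ~> R).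
Hypothesis kP : is_cond_law P X W k.
Variables (D : set nat) (x : nat -> R) (l : R.-pker (E * R) ~> R).
Hypothesis lP : is_cond_law P U (fun w => (W w, X w)) l.
Hypothesis lE : {ae P, forall w, forall i, D i -> X w = x i ->
  forall (lt_nu : cond_cum k x i (W w) < cond_cum k x i.+1 (W w))
         (B : set R), measurable B -> l (W w, X w) B = uniform_prob lt_nu B}.

(** The conditional probability, given [W = z], that [X = x i] and [U < u]: the mass of the atom
    times the uniform probability of the ray, with the division cancelled. *)
Let h (u : R) i z :=
  Num.min u (cond_cum k x i.+1 z) - Num.min u (cond_cum k x i z).

Let h_ge0 u i z : 0 <= h u i z.
Proof. by rewrite subr_ge0; apply: le_min2 => //; exact: le_cond_cumS. Qed.

Let measurable_h u i : measurable_fun [set: E] (h u i).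
Proof.
by apply: measurable_funB; apply: measurable_minr => //; exact: measurable_cond_cum.
Qed.

Lemma atom_uniform (A : set E) (u : R) i : D i -> measurable A ->
  P (W @^-1` A `&` X @^-1` [set x i] `&` U @^-1` `]-oo, u[) =
  (\int[P]_(w in W @^-1` A) (Num.min u (cond_cum k x i.+1 (W w)) -
      Num.min u (cond_cum k x i (W w)))%:E)%E.
Proof.
move=> Di mA.
have mWA : measurable (W @^-1` A) by exact: measurable_funPTI.
have mXx : measurable (X @^-1` [set x i]) by exact: measurable_funPTI.
have mWX : measurable_fun [set: T] (fun w => (W w, X w)).
  exact: measurable_fun_pair.
have mI : measurable (W @^-1` A `&` X @^-1` [set x i]) by exact: measurableI.
transitivity (P ((fun w => (W w, X w)) @^-1` (A `*` [set x i])
    `&` U @^-1` `]-oo, u[)); first by [].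
rewrite lP//; last exact: measurableX.
(* If [nu_i = nu_{i+1}] the division by 0 is harmless: the factor [pi_{i+1}]
   that [g] gets multiplied by is then 0. *)
pose g z := (h u i z / (cond_cum k x i.+1 z - cond_cum k x i z))%:E.
have mg : measurable_fun [set: E] g.
  apply/measurable_EFinP; apply: measurable_funM; first exact: measurable_h.
  have nu_ge0 z : 0 <= cond_cum k x i.+1 z - cond_cum k x i z.
    by rewrite subr_ge0 le_cond_cumS.
  (* On nonnegative reals the inverse is the power of exponent -1, whose measurability is
     available. *)
  under eq_fun do rewrite -powR_inv1//.
  apply: (measurableT_comp (measurable_powR _)); apply: measurable_funB;
    exact: measurable_cond_cum.
have g0 z : (0 <= g z)%E.
  by rewrite lee_fin divr_ge0 ?h_ge0// subr_ge0 le_cond_cumS.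
transitivity (\int[P]_(w in W @^-1` A `&` X @^-1` [set x i]) g (W w))%E.
  apply: ge0_ae_eq_integral => //.
  - apply: measurable_funTS; have mr : measurable `]-oo, u[%classic by [].
    exact: (measurableT_comp (measurable_kernel l _ mr) mWX).
  - by apply: measurable_funTS; exact: measurableT_comp.
  (* Almost surely on [X = x i] the atom has positive conditional mass, which supplies the proof
     [lt_nu] required by [lE]. *)
  - have := cond_law_gt0 kP (measurable_set1 (x i)).
    apply: filterS2 lE => w lw kw [_ Xw].
    have lt_nu : cond_cum k x i (W w) < cond_cum k x i.+1 (W w).
      rewrite cond_cumS ltrDl fine_gt0// kw//=.
      by rewrite -ge0_fin_numE ?pker_fin_num.
    by rewrite (lw _ Di Xw lt_nu)// uniform_prob_lt.
rewrite (cond_law_integral kP)//.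
apply: eq_integral => w _; rewrite /g.
have -> : cond_cum k x i.+1 (W w) - cond_cum k x i (W w) =
    fine (k (W w) [set x i]) by rewrite cond_cumS addrC addKr.
rewrite -[X in (_ * X)%E]fineK ?pker_fin_num//.
rewrite -EFinM; congr EFin.
have [k0|k0] := eqVneq (fine (k (W w) [set x i])) 0; last by rewrite mulfVK.
by rewrite k0 mulr0 cond_cumS k0 addr0 subrr.
Qed.

(** Each new atom moves the upper endpoint from nu_n to nu_{n+1}; the lower one stays at nu_0 = 0,
    whence [Num.min u 0]. *)
Lemma atoms_uniform (A : set E) (u : R) n :
  `I_n `<=` D -> {in `I_n &, injective x} -> measurable A ->
  P (W @^-1` A `&` X @^-1` (x @` `I_n) `&` U @^-1` `]-oo, u[) =
  (\int[P]_(w in W @^-1` A) (Num.min u (cond_cum k x n (W w)) -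
      Num.min u 0)%:E)%E.
Proof.
move=> + + mA.
have mWA : measurable (W @^-1` A) by exact: measurable_funPTI.
have mU : measurable (U @^-1` `]-oo, u[%classic) by exact: measurable_funPTI.
have mX n' : measurable (X @^-1` (x @` `I_n')).
  by apply: measurable_funPTI; exact: measurable_image_II.
elim: n => [_ _|n IHn nD xI].
  rewrite II0 image_set0 preimage_set0 setI0 set0I measure0.
  by rewrite integral0_eq// => w _; rewrite cond_cum0 subrr.
rewrite IIS image_setU image_set1 preimage_setU setIUr setIUl measureU; last 3 first.
- by do 2 apply: measurableI => //.
- by do 2 apply: measurableI => //; exact: measurable_funPTI.
- rewrite -subset0 => w [[[_ [i /= iI <-]] _] [[_ /= xin] _]].
  have := xI _ _ _ _ xin; rewrite !inE/= => /(_ (ltnW iI) (ltnSn _)) E'.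
  by rewrite E' ltnn in iI.
rewrite [X in (X + _)%E]IHn; last 2 first.
- by move=> i /= iI; apply: nD; exact: ltnW.
- by move=> i j; rewrite !inE => iI jI; apply: xI; rewrite inE/=; exact: ltnW.
rewrite [X in (_ + X)%E]atom_uniform//; last by apply: nD => /=; exact: ltnSn.
rewrite -ge0_integralD//; last 4 first.
- by move=> w _; rewrite lee_fin subr_ge0 le_min2// cond_cum_ge0.
- apply/measurable_EFinP/measurable_funTS/measurable_funB => //.
  by apply: measurable_minr => //; apply: measurableT_comp => //; exact: measurable_cond_cum.
- by move=> w _; rewrite lee_fin h_ge0.
- apply/measurable_EFinP/measurable_funTS.
  by apply: (@measurableT_comp _ _ _ _ _ _ (h u n)).
by apply: eq_integral => w _; rewrite -EFinD addrC addrA subrK.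
Qed.

End atoms.

(* Finitely many atoms carry all the mass up to [e], so that no limit has to be
   exchanged with an integral. *)
Lemma atomic_support_approx (d : measure_display) (T : measurableType d)
    (R : realType) (P : probability T R) (X : {mfun T >-> R})
    (D : set nat) (x : nat -> R) (e : R) :
  atomic_support P X D x -> 0 < e ->
  exists2 n, `I_n `<=` D & (P (~` (X @^-1` (x @` `I_n))) <= e%:E)%E.
Proof.
move=> [Dn _ _ PD] e0.
have mX n : measurable (X @^-1` (x @` `I_n)).
  by apply: measurable_funPTI; exact: measurable_image_II.
case: Dn => [[n DE]|DE]; rewrite {}DE in PD *.
  by exists n => //; rewrite probability_setC// PD subee// lee_fin ltW.
pose F n := X @^-1` (x @` `I_n).
have UF : \bigcup_n F n = X @^-1` (x @` [set: nat]).
  apply/seteqP; split => w; first by move=> [n _ [i _ xi]]; exists i.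
  by move=> [i _ xi]; exists i.+1 => //; exists i => /=.
have cF : (P \o F) n @[n --> \oo] --> 1%E.
  rewrite -PD -UF; apply: nondecreasing_cvg_mu => //.
    by apply: bigcup_measurable => n _; exact: mX.
  move=> m n mn; apply/subsetPset => w [i /= im xi]; exists i => //=.
  exact: leq_trans mn.
have /fine_cvgP[_ /cvgr_gt] := cF.
have e1 : 1 - e < fine 1%E :> R by rewrite /= ltrBlDr ltrDl.
move=> /(_ _ e1) [n _ /(_ n (leqnn n)) Pn].
exists n => //; rewrite probability_setC// -(fineK (fin_num_measure P _ (mX n))).
by rewrite -EFinB lee_fin lerBlDr -lerBlDl ltW.
Qed.

Section atomic_case_uniform.
Context (d d1 : measure_display) (T : measurableType d)
  (E : measurableType d1) (R : realType) (P : probability T R)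
  (X U : {mfun T >-> R}) (W : {mfun T >-> E}) (k : R.-pker E ~> R).
Hypothesis kP : is_cond_law P X W k.

Lemma atomic_case_unif (A : set E) (u : R) :
  atomic_case P X U W k -> measurable A ->
  P (W @^-1` A `&` U @^-1` `]-oo, u[) = ((unif_cdf u)%:E * P (W @^-1` A))%E.
Proof.
move=> [D [x [suppD [l lP lE]]]] mA.
have xI n : `I_n `<=` D -> {in `I_n &, injective x}.
  case: suppD => _ xlt _ _ nD i j; rewrite !inE => /nD Di /nD Dj xij.
  have [ij|ji|//] := ltngtP i j.
    by have := xlt _ _ Di Dj ij; rewrite xij ltxx.
  by have := xlt _ _ Dj Di ji; rewrite xij ltxx.
have mWA : measurable (W @^-1` A) by exact: measurable_funPTI.
have mU : measurable (U @^-1` `]-oo, u[%classic) by exact: measurable_funPTI.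
have mWU : measurable (W @^-1` A `&` U @^-1` `]-oo, u[) by exact: measurableI.
have mX n : measurable (X @^-1` (x @` `I_n)).
  by apply: measurable_funPTI; exact: measurable_image_II.
have nu_le1 n z : `I_n `<=` D -> cond_cum k x n z <= 1.
  move=> nD; rewrite -lee_fin -cond_cumE; last exact: xI.
  by apply: pker_le1; exact: measurable_image_II.
pose f n w := Num.min u (cond_cum k x n (W w)) - Num.min u 0.
have mf n : measurable_fun [set: T] (f n).
  apply: measurable_funB => //; apply: measurable_minr => //.
  by apply: measurableT_comp => //; exact: measurable_cond_cum.
have f0 n w : 0 <= f n w by rewrite subr_ge0 le_min2// cond_cum_ge0.
have c0 := unif_cdf_ge0 u.
have cE : ((unif_cdf u)%:E * P (W @^-1` A) =
    \int[P]_(w in W @^-1` A) (unif_cdf u)%:E)%E by rewrite integral_cst.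
rewrite cE; apply/eqP; rewrite eq_le; apply/andP; split;
  apply/lee_addgt0Pr => e e0;
  have [n nD Pn] := atomic_support_approx suppD e0;
  have := atoms_uniform kP lP lE u nD (xI n nD) mA; rewrite -/(f n _) => Pf.
(* Upper bound: outside the first [n] atoms the event costs at most [e], and on them nu_n <= 1
   bounds the integrand by [unif_cdf u]. *)
- apply: (@le_trans _ _ (P (W @^-1` A `&` X @^-1` (x @` `I_n) `&` U @^-1` `]-oo, u[)
      + P (~` (X @^-1` (x @` `I_n))))%E).
    rewrite (measureDI P mWU (mX n)) addeC; apply: leeD.
      by rewrite setIAC.
    by apply: le_measure; rewrite ?inE; [exact: measurableD|exact: measurableC|].
  apply: leeD => //; rewrite Pf; apply: ge0_le_integral => //.
  + by move=> w _; exact: f0.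
  + by apply/measurable_EFinP/measurable_funTS; exact: mf.
  + by move=> w _; rewrite lee_fin lerD2r le_min2// nu_le1.
(* Lower bound: min(u, 1) <= min(u, nu_n) + (1 - nu_n), and 1 - nu_n is the conditional mass of the
   complement of the first [n] atoms, whose integral is at most [e]. *)
- have mS := measurableC (measurable_image_II x n).
  have mk : measurable_fun [set: T] (fun w => k (W w) (~` (x @` `I_n))).
    exact: (measurableT_comp (measurable_kernel k _ mS)).
  have mfE : measurable_fun (W @^-1` A) (fun w => (f n w)%:E).
    exact/measurable_EFinP/measurable_funTS.
  apply: (@le_trans _ _ (\int[P]_(w in W @^-1` A) ((f n w)%:E +
      k (W w) (~` (x @` `I_n))))%E).
    apply: ge0_le_integral => //.
    + by apply: emeasurable_funD => //; exact: measurable_funTS.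
    + move=> w _; have mI := measurable_image_II x n.
      rewrite pker_setC// cond_cumE; last exact: xI.
      rewrite -EFinB -EFinD lee_fin /unif_cdf addrAC lerD2r.
      have nu1 := nu_le1 n (W w) nD.
      have [u_nu|nu_u] := leP u (cond_cum k x n (W w)).
        by rewrite (le_trans (y := u)) ?ge_min ?lexx// lerDl subr_ge0.
      by rewrite addrC subrK ge_min lexx orbT.
  rewrite ge0_integralD//; last 2 first.
  + by move=> w _; rewrite lee_fin.
  + exact: measurable_funTS.
  apply: leeD.
    rewrite -Pf; apply: le_measure; rewrite ?inE//.
      by do 2 apply: measurableI => //.
    by move=> w [[]].
  rewrite -kP//; apply: le_trans Pn.
  have mXC := measurableC (mX n).
  by apply: le_measure; rewrite ?inE//; exact: (measurableI _ _ mWA mXC).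
Qed.

End atomic_case_uniform.

(** * Independence *)

Section independence.
Context (d d1 : measure_display) (T : measurableType d)
  (E : measurableType d1) (R : realType) (P : probability T R).

(** For fixed [A], both sides are finite measures in [B], so agreement on a generating pi-system
    suffices. *)
Lemma independent_rv_pi d2 (Y : measurableType d2) (W : {mfun T >-> E})
    (V : {mfun T >-> Y}) (G : set (set Y)) (g : (set Y)^nat) :
  @measurable _ Y = <<s G >> -> setI_closed G ->
  (forall i, G (g i)) -> \bigcup_i g i = setT ->
  (forall A B, measurable A -> G B ->
    P (W @^-1` A `&` V @^-1` B) = (P (W @^-1` A) * P (V @^-1` B))%E) ->
  independent_rv P W V.
Proof.
move=> GE GI Gg gT PG A B mA mB.
have mWA : measurable (W @^-1` A) by exact: measurable_funPTI.
pose r : {nonneg R} := NngNum (fine_ge0 (measure_ge0 P (W @^-1` A))).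
have rE : P (W @^-1` A) = (r%:num)%:E by rewrite fineK ?fin_num_measure.
have := @measure_unique _ R Y G g GE GI Gg gT
  (pushforward (mrestr P mWA) V) (mscale r (distribution P V)).
rewrite rE setIC; apply => //.
- move=> C GC; rewrite -[LHS]/(P (V @^-1` C `&` W @^-1` A)) setIC PG//.
  by rewrite rE.
- move=> i; rewrite -[X in (X < _)%E]/(P (V @^-1` (g i) `&` W @^-1` A)).
  rewrite -ge0_fin_numE// fin_num_measure//; apply: measurableI => //.
  by apply: measurable_funPTI; rewrite GE; exact: sub_gen_smallest.
Qed.

(** The case [A = setT] identifies [c u] with P[U < u]. *)
Lemma independent_rv_rays (W : {mfun T >-> E}) (U : {mfun T >-> R})
    (c : R -> R) :
  (forall A u, measurable A ->
    P (W @^-1` A `&` U @^-1` `]-oo, u[) = ((c u)%:E * P (W @^-1` A))%E) ->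
  independent_rv P W U.
Proof.
move=> cP; apply: (@independent_rv_pi _ _ _ _ (@RGenInftyO.G R)
  (fun n => `]-oo, n%:R[%classic)).
- exact: RGenInftyO.measurableE.
- move=> _ _ [x ->] [y ->]; exists (Num.min x y).
  by apply/seteqP; split => z /=; rewrite !in_itv/= lt_min => /andP.
- by move=> n; exists n%:R.
- rewrite -subTset => z _; exists (Num.truncn z).+1 => //=.
  by rewrite in_itv/= truncnS_gt.
- move=> A B mA [u ->]; rewrite cP// muleC; congr (_ * _)%E.
  have := cP setT u measurableT.
  by rewrite preimage_setT setTI probability_setT mule1 => ->.
Qed.

(** [f] is extended-valued because [ginv] may be infinite; [V \in B] is replaced, up to a null
    event, by the event that [f (U w)] is the embedding of a point of [B]. *)
Lemma independent_rv_ae_comp (W : {mfun T >-> E}) (U V : {mfun T >-> R})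
    (f : R -> \bar R) :
  measurable_fun [set: R] f -> {ae P, forall w, (V w)%:E = f (U w)} ->
  independent_rv P W U -> independent_rv P W V.
Proof.
move=> mf VU WU A B mA mB.
have mB' : measurable (f @^-1` (EFin @` B)).
  by rewrite -[X in measurable X]setTI; apply: mf => //; exact: measurable_image_EFin.
have mWA : measurable (W @^-1` A) by exact: measurable_funPTI.
have mV : measurable (V @^-1` B) by exact: measurable_funPTI.
have mU : measurable (U @^-1` (f @^-1` (EFin @` B))) by exact: measurable_funPTI.
have VB w : (V w)%:E = f (U w) -> B (V w) <-> (U @^-1` (f @^-1` (EFin @` B))) w.
  move=> VUw; split => [BV|/= [v Bv]]; first by exists (V w).
  by rewrite -VUw => -[<-].
rewrite (ae_iff_measure (B := U @^-1` (f @^-1` (EFin @` B))) mV mU); last first.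
  by apply: filterS VU => w /VB.
rewrite -WU//; apply: ae_iff_measure; [exact: measurableI|exact: measurableI|].
by apply: filterS VU => w /VB VBw; split => -[WA /VBw].
Qed.

End independence.

(** * Measurability of the generalized inverse *)

Lemma ginv_nondecreasing (R : realType) (F : R -> R) :
  {homo ginv F : p q / p <= q >-> (p <= q)%E}.
Proof.
move=> p q pq; apply: le_ereal_sup; apply: image_subset => x /= Fx.
exact: le_trans pq.
Qed.

(** By monotonicity the preimage of an upper ray is an interval. *)
Lemma measurable_ginv (R : realType) (F : R -> R) :
  measurable_fun [set: R] (ginv F).
Proof.
apply: (measurability _ (ErealGenOInfty.measurableE R)) => _ /= -[_ [r ->] <-].
rewrite setTI; apply: is_interval_measurable => p q /=.
rewrite !in_itv/= !andbT => rp rq x /andP[px _].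
rewrite in_itv/= andbT; apply: (lt_le_trans rp); exact: ginv_nondecreasing.
Qed.

(** * Boxes and a countable generating pi-system *)

Definition tuple_box (n : nat) (Y : Type) (B : 'I_n -> set Y) : set (n.-tuple Y) :=
  [set t | forall j, B j (tnth t j)].

Lemma measurable_tuple_box (n : nat) d (Y : measurableType d)
    (B : 'I_n -> set Y) :
  (forall j, measurable (B j)) -> measurable (tuple_box B).
Proof.
move=> mB; rewrite (_ : tuple_box B =
    \big[setI/setT]_(j < n) (fun t : n.-tuple Y => tnth t j) @^-1` B j).
  apply: bigsetI_measurable => j _; rewrite -[X in measurable X]setTI.
  exact: measurable_tnth.
rewrite -bigcap_seq; apply/seteqP; split => t /= tB j.
  by move=> _; exact: tB.
by apply: tB => /=; rewrite mem_index_enum.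
Qed.

Lemma tuple_box_setI (n : nat) (Y : Type) (A B : 'I_n -> set Y) :
  tuple_box A `&` tuple_box B = tuple_box (fun j => A j `&` B j).
Proof.
apply/seteqP; split => t; first by move=> [tA tB] j; split.
by move=> tAB; split => j; have [] := tAB j.
Qed.

(** The product sigma-algebra is generated by the coordinates, and constraining one coordinate is a
    box whose other sides are [setT]; this is where [C setT] enters. *)
Lemma measurable_tuple_boxE (n : nat) d (Y : measurableType d) (C : set (set Y)) :
  @measurable _ Y = <<s C >> -> C setT ->
  @measurable _ (n.-tuple Y) =
    <<s [set tuple_box B | B in [set B | forall j : 'I_n, C (B j)]] >>.
Proof.
move=> CE CT; set G := (X in _ = <<s X >>).
apply/seteqP; split; last first.
  apply: smallest_sub; first exact: sigma_algebra_measurable.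
  move=> _ [B CB <-]; apply: measurable_tuple_box => j.
  by rewrite CE; exact: sub_gen_smallest.
have : measurable_fun [set: g_sigma_algebraType G] (id : _ -> n.-tuple Y).
  apply/measurable_fun_tnthP => i; apply: (measurability _ CE).
  move=> _ [B CB <-]; rewrite setTI; apply: sub_gen_smallest.
  exists (fun j => if j == i then B else setT).
    by move=> j /=; case: ifPn.
  apply/seteqP; split => t /=; first by move=> /(_ i); rewrite eqxx.
  by move=> Bt j; case: ifPn => // /eqP ->.
by move=> mid A mA; have := mid measurableT A mA; rewrite setTI.
Qed.

(** [None] stands for an unconstrained coordinate; the index type stays countable. *)
Definition rat_ray (R : realType) (o : option rat) : set R :=
  if o is Some q then `]-oo, ratr q[%classic else setT.

Lemma rat_ray_setI (R : realType) (o1 o2 : option rat) :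
  exists o, @rat_ray R o1 `&` @rat_ray R o2 = @rat_ray R o.
Proof.
case: o1 o2 => [q1|] [q2|].
- exists (Some (Num.min q1 q2)); apply/seteqP; split => x /=; rewrite !in_itv/=.
    by move=> [xq1 xq2]; case: (leP q1 q2).
  move=> xq; split; apply: lt_le_trans xq _; rewrite ler_rat.
    by rewrite ge_min lexx.
  by rewrite ge_min lexx orbT.
- by exists (Some q1); rewrite setIT.
- by exists (Some q2); rewrite setTI.
- by exists None; rewrite setTI.
Qed.

Lemma measurable_rat_ray (R : realType) (o : option rat) :
  measurable (@rat_ray R o).
Proof. by case: o => [q|] /=. Qed.

Lemma measurable_rat_rayE (R : realType) :
  @measurable _ R = <<s range (@rat_ray R) >>.
Proof.
apply/seteqP; split; last first.
  apply: smallest_sub; first exact: sigma_algebra_measurable.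
  by move=> _ [q _ <-]; exact: measurable_rat_ray.
rewrite [X in X `<=` _]RGenInftyO.measurableE.
apply: smallest_sub; first exact: smallest_sigma_algebra.
move=> _ [x ->].
(* An open ray is the union of the rational rays with endpoint below [x]; the other rationals
   contribute the empty set. *)
pose F (q : rat) : set R := if ratr q < x then `]-oo, ratr q[%classic else set0.
rewrite (_ : `]-oo, x[%classic = \bigcup_(q : rat) F q); last first.
  apply/seteqP; split => y /=; rewrite in_itv/=.
    move=> /rat_in_itvoo[q]; rewrite in_itv/= => /andP[yq qx].
    by exists q => //; rewrite /F qx /= in_itv.
  move=> [q _]; rewrite /F; case: ifPn => //= qx; rewrite in_itv/= => yq.
  exact: lt_trans qx.
apply: (@bigcupT_measurable_rat _ (g_sigma_algebraType (range (@rat_ray R)))) => q.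
rewrite /F; case: ifPn => _; last exact: measurable0.
by apply: sub_gen_smallest; exists (Some q).
Qed.

(* A countable generating pi-system: an identity between random measures that
   holds almost surely on each of its members holds almost surely on all of
   them simultaneously. *)
Section rat_box.
Variables (R : realType) (n : nat).

(** Enumerates by naturals the boxes coded by finite functions into [option rat]; an index that
    decodes to nothing gives the whole space. *)
Definition rat_box (i : nat) : set (n.-tuple R) :=
  tuple_box (fun j => @rat_ray R
    (if unpickle i is Some b then (b : {ffun 'I_n -> option rat}) j else None)).

Lemma range_rat_box : range rat_box =
  [set tuple_box B | B in [set B | forall j : 'I_n, range (@rat_ray R) (B j)]].
Proof.
apply/seteqP; split.
  by move=> _ [i _ <-]; eexists; last reflexivity; move=> j /=; eexists.
move=> _ [B /= BR <-]; have /choice[b bB] : forall j, exists o, @rat_ray R o = B j.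
  by move=> j; have [r _ <-] := BR j; exists r.
exists (pickle (finfun b)) => //; rewrite /rat_box pickleK; congr tuple_box.
by apply/funext => j; rewrite ffunE.
Qed.

Lemma measurable_rat_boxE : @measurable _ (n.-tuple R) = <<s range rat_box >>.
Proof.
rewrite range_rat_box; apply: measurable_tuple_boxE; last by exists None.
exact: measurable_rat_rayE.
Qed.

Lemma rat_box_setI : setI_closed (range rat_box).
Proof.
rewrite range_rat_box => _ _ [A /= AR <-] [B /= BR <-].
rewrite tuple_box_setI; eexists; last reflexivity.
move=> j /=; have [r1 _ <-] := AR j; have [r2 _ <-] := BR j.
by have [r ->] := @rat_ray_setI R r1 r2; exists r.
Qed.

Lemma rat_boxT : range rat_box setT.
Proof.
rewrite range_rat_box; exists (fun=> setT); first by move=> j; exists None.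
by apply/seteqP; split.
Qed.

End rat_box.

(** * Chaining the independences over the coordinates *)

Section sequential_independence.
Context (d : measure_display) (T : measurableType d) (R : realType)
  (P : probability T R) (dx dz : nat)
  (Z : {mfun T >-> dz.-tuple R}) (Xt : {mfun T >-> dx.-tuple R}).

Lemma measurable_coord (j : 'I_dx) :
  measurable_fun [set: T] (fun w => tnth (Xt w) j).
Proof. exact: measurableT_comp (measurable_tnth j) _. Qed.

Lemma measurable_augmented (j : 'I_dx) :
  measurable_fun [set: T] (augmented Z Xt j).
Proof.
apply: measurable_fun_pair => //; apply/measurable_fun_tnthP => i.
rewrite (_ : _ \o _ = fun w => tnth (Xt w) (widen_ord (ltnW (ltn_ord j)) i)).
  exact: measurable_coord.
by apply/funext => w /=; rewrite tnth_mktuple.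
Qed.

Hypothesis indep : forall j : 'I_dx,
  independent_rv P (augmented Z Xt j) (fun w => tnth (Xt w) j).

Lemma sequential_independence (A : set (dz.-tuple R)) (B : 'I_dx -> set R) :
  measurable A -> (forall j, measurable (B j)) ->
  P (Z @^-1` A `&` Xt @^-1` tuple_box B) =
  (P (Z @^-1` A) * \prod_(j < dx) P ((fun w => tnth (Xt w) j) @^-1` B j))%E.
Proof.
(* [M m] constrains the coordinates of index below [m]. Together with [Z \in A] it is a rectangle
   event for the augmented vector at index [m], so [indep] splits off coordinate [m]. *)
move=> mA mB; pose M m := [set w | forall j : 'I_dx, (j < m)%N -> B j (tnth (Xt w) j)].
have step m : (m <= dx)%N -> P (Z @^-1` A `&` M m) = (P (Z @^-1` A) *
    \prod_(j < dx | (j < m)%N) P ((fun w => tnth (Xt w) j) @^-1` B j))%E.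
  elim: m => [_|m IHm mdx].
    rewrite big_pred0// mule1 (_ : M 0 = setT) ?setIT//.
    by apply/seteqP; split.
  pose j := Ordinal mdx.
  pose C : set (m.-tuple R) := tuple_box (fun i => B (widen_ord (ltnW mdx) i)).
  have mC : measurable C by exact: measurable_tuple_box.
  have CE : Z @^-1` A `&` M m = augmented Z Xt j @^-1` (A `*` C).
    apply/seteqP; split => w [ZA Mw]; split => //= i.
      rewrite tnth_mktuple.
      rewrite (_ : widen_ord _ i = widen_ord (ltnW mdx) i); last exact: val_inj.
      exact: (Mw (widen_ord (ltnW mdx) i) (ltn_ord i)).
    move=> im; have := Mw (Ordinal im); rewrite /= tnth_mktuple.
    rewrite (_ : widen_ord (ltnW mdx) _ = i); last exact: val_inj.
    by rewrite (_ : widen_ord _ _ = i)//; exact: val_inj.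
  have -> : Z @^-1` A `&` M m.+1 = augmented Z Xt j @^-1` (A `*` C) `&`
      (fun w => tnth (Xt w) j) @^-1` B j.
    rewrite -CE -setIA; congr setI; apply/seteqP; split => w.
      move=> Mw; split => /= [i im|]; first by apply: Mw; exact: ltnW.
      exact: (Mw j (ltnSn m)).
    move=> [Mw Bw] i; rewrite ltnS leq_eqVlt => /predU1P[im|]; last exact: Mw.
    by rewrite (_ : i = j)//; exact: val_inj.
  rewrite indep//; last exact: measurableX.
  rewrite -CE IHm ?(ltnW mdx)// -muleA; congr (_ * _)%E.
  rewrite [RHS](bigD1 j)//= muleC; congr (_ * _)%E; apply: eq_bigl => i.
  by rewrite ltnS andbC -(inj_eq val_inj) /= -ltn_neqAle.
have -> : Xt @^-1` tuple_box B = M dx.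
  apply/seteqP; split => w; first by move=> Bw j _; exact: Bw.
  by move=> Mw j; exact: Mw.
rewrite step//; congr (_ * _)%E; apply: eq_bigl => j.
exact: ltn_ord.
Qed.

Lemma coords_product (B : 'I_dx -> set R) : (forall j, measurable (B j)) ->
  P (Xt @^-1` tuple_box B) =
  (\prod_(j < dx) P ((fun w => tnth (Xt w) j) @^-1` B j))%E.
Proof.
move=> mB; have := sequential_independence measurableT mB.
by rewrite preimage_setT setTI probability_setT mul1e.
Qed.

Lemma tuple_independent : independent_rv P Z Xt.
Proof.
apply: (independent_rv_pi (G := range (@rat_box R dx)) (g := fun=> setT)).
- exact: measurable_rat_boxE.
- exact: rat_box_setI.
- by move=> _; exact: rat_boxT.
- by rewrite bigcup_const.
- move=> A _ mA [i _ <-].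
  have mr (j : 'I_dx) := @measurable_rat_ray R
    (if unpickle i is Some b then (b : {ffun 'I_dx -> option rat}) j else None).
  by rewrite /rat_box sequential_independence// coords_product.
Qed.

End sequential_independence.

Lemma independent_rv_sym (d d1 d2 : measure_display) (T : measurableType d)
    (Y1 : measurableType d1) (Y2 : measurableType d2) (R : realType)
    (P : probability T R) (V : T -> Y1) (W : T -> Y2) :
  independent_rv P V W -> independent_rv P W V.
Proof. by move=> VW A B mA mB; rewrite setIC VW// muleC. Qed.

(** * Conditional laws under independence *)

Section cond_law_independent.
Context (d d1 d2 : measure_display) (T : measurableType d)
  (E : measurableType d1) (Y : measurableType d2) (R : realType)
  (P : probability T R) (V : {mfun T >-> Y}) (W : {mfun T >-> E}).
Hypothesis WV : independent_rv P W V.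

(** The constant kernel equal to the law of [V] is a version. *)
Lemma cond_law_cst :
  exists K : R.-pker E ~> Y, is_cond_law P V W K.
Proof.
pose p : pprobability Y R := distribution P V.
exists (kprobability (@measurable_cst _ _ E (pprobability Y R) setT p)).
move=> A B mA mB; rewrite WV// integral_cst; last exact: measurable_funPTI.
by rewrite muleC.
Qed.

(** As functions of the value of [W], both sides have the same integral over every measurable set
    for the law of [W], hence agree outside a null set, which is pulled back by [W]. That set
    depends on [B]. *)
Lemma cond_law_ae_cst (K : R.-pker E ~> Y) (B : set Y) :
  is_cond_law P V W K -> measurable B ->
  {ae P, forall w, K (W w) B = P (V @^-1` B)}.
Proof.
move=> KP mB.
have mK : measurable_fun [set: E] (K ^~ B) by exact: measurable_kernel.
have [N [mN N0 KN]] : ae_eq (distribution P W) setT (K ^~ B)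
    (fun=> P (V @^-1` B)).
  apply: integral_ae_eq => //.
  - apply: (le_integrable measurableT mK (g := EFin \o cst 1)).
      by move=> z _ /=; rewrite gee0_abs// normr1 pker_le1.
    exact: finite_measure_integrable_cst.
  - move=> A _ mA; rewrite integral_cst//.
    transitivity (P (W @^-1` A `&` V @^-1` B)); last by rewrite WV// muleC.
    rewrite KP// [LHS]ge0_integral_pushforward//.
    exact: measurable_funTS.
exists (W @^-1` N); split.
- exact: measurable_funPTI.
- exact: N0.
- move=> w /= KW; apply: KN => /=; apply: contra_not KW; exact.
Qed.

End cond_law_independent.

Theorem mainTheorem1 (d : measure_display) (T : measurableType d)
    (R : realType) (P : probability T R) (dx dz : nat)
    (X : {RV P >-> dx.-tuple R}) (Z : {RV P >-> dz.-tuple R})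
    (F : 'I_dx -> cumulativeBounded (0 : R) (1 : R))
    (Xt : {RV P >-> dx.-tuple R}) (U : 'I_dx -> {RV P >-> R})
    (k : forall j : 'I_dx, R.-pker (dz.-tuple R * j.-tuple R) ~> R)
    (hk : forall j : 'I_dx,
      is_cond_law P (fun w => tnth (X w) j) (augmented Z Xt j) (k j))
    (hXt : forall j : 'I_dx,
      {ae P, forall w, (tnth (Xt w) j)%:E = ginv (F j) (U j w)})
    (hU : forall j : 'I_dx,
      continuous_case P (fun w => tnth (X w) j) (U j) (augmented Z Xt j) (k j)
      \/
      atomic_case P (fun w => tnth (X w) j) (U j) (augmented Z Xt j) (k j)) :
  [/\ (exists K : R.-pker dz.-tuple R ~> dx.-tuple R, is_cond_law P Xt Z K),
      (forall K : R.-pker dz.-tuple R ~> dx.-tuple R, is_cond_law P Xt Z K ->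
        {ae P, forall w, is_product_law (K (Z w))
          (fun j => pushforward P (fun w' => tnth (Xt w') j))}) &
      independent_rv P Xt Z].
Proof.
have indep (j : 'I_dx) :
    independent_rv P (augmented Z Xt j) (fun w => tnth (Xt w) j).
  pose W : {mfun T >-> _} :=
    mfun_Sub (mem_set (measurable_augmented Z Xt (j := j)) : _ \in mfun).
  pose Xj : {mfun T >-> R} :=
    mfun_Sub (mem_set (measurable_coord X j) : _ \in mfun).
  pose Xtj : {mfun T >-> R} :=
    mfun_Sub (mem_set (measurable_coord Xt j) : _ \in mfun).
  have kj : is_cond_law P Xj W (k j) := hk j.
  have UW : independent_rv P W (U j).
    (* Both cases yield the same factor [unif_cdf u], free of [A]. *)
    apply: (independent_rv_rays (c := @unif_cdf R)) => A u mA.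
    case: (hU j) => UE; first exact: (continuous_case_unif kj u UE mA).
    exact: (atomic_case_unif kj u UE mA).
  exact: (independent_rv_ae_comp (V := Xtj) (measurable_ginv (F j)) (hXt j) UW).
have ZXt := tuple_independent indep.
split; [exact: cond_law_cst | | exact: independent_rv_sym].
move=> K KP.
have : {ae P, forall w, forall i, K (Z w) (@rat_box R dx i) =
    P (Xt @^-1` @rat_box R dx i)}.
  apply/ae_foralln => i; apply: cond_law_ae_cst => //.
  by rewrite measurable_rat_boxE; apply: sub_gen_smallest; exists i.
apply: filterS => w KZ B mB.
(* The product of the marginals is the law of [Xt] on the box, so it remains to compare two
   measures, [K (Z w)] and the law of [Xt], which agree on the rational boxes. *)
rewrite -[RHS](coords_product indep mB).
apply: (measure_unique (range (@rat_box R dx)) (fun=> setT) _ _ _ _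
  (K (Z w)) (distribution P Xt)).
- exact: measurable_rat_boxE.
- exact: rat_box_setI.
- by move=> _; exact: rat_boxT.
- by rewrite bigcup_const.
- by move=> _ [i _ <-]; exact: KZ.
- by move=> _; rewrite prob_kernel ltry.
- exact: measurable_tuple_box.
Qed.
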